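(* Let $\mathbb{F}_q$ be a finite field, let $a\in\mathbb{F}_q$ be a non-square in $\mathbb{F}_q$, let $b\in\mathbb{F}_{q^2}\setminus\mathbb{F}_q$ satisfy $b^2=a$, and let $n$ be a positive integer such that $\operatorname{rad}(n)$ divides $q-1$. Then for every irreducible factor $f(x)$ of $D_n(x,a)$ in $\mathbb{F}_q[x]$ there exist $\alpha\in\mathbb{F}_{q^2}^*$ and a positive divisor $t$ of $\frac{4n}{\gcd(4n,q^2-1)}$ satisfying (i) $\alpha^{2n/t}=-1$, (ii) $\operatorname{rad}(t)$ divides $\operatorname{ord}_{q^2}(\alpha)$, (iii) $\gcd\left(t,\frac{q^2-1}{\operatorname{ord}_{q^2}(\alpha)}\right)=1$, such that $f(x)$ is of the following form: (a) $f(x)=D_t(x,a)-b^t(\alpha+\alpha^{-1})$ in the case that either $t$ is even and ($\alpha\in\mathbb{F}_q^*$ or $\alpha^{q+1}=1$), or $t$ is odd and ($\alpha^{q-1}=-1$ or $\alpha^{q+1}=-1$); (b) $f(x)=\left(D_t(x,a)-b^t(\alpha+\alpha^{-1})\right)\left(D_t(x,a)-b^{qt}(\alpha^q+\alpha^{-q})\right)$ otherwise.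
   Context: For $n\ge 1$ and $a\in\mathbb{F}_q$, the $n$-th Dickson polynomial of the first kind with parameter $a$ is $D_n(x,a)=\sum_{i=0}^{\lfloor n/2\rfloor}\frac{n}{n-i}\binom{n-i}{i}(-a)^i x^{n-2i}\in\mathbb{F}_q[x]$ (the numbers $\frac{n}{n-i}\binom{n-i}{i}$ are integers, viewed in $\mathbb{F}_q$). $\operatorname{rad}(n)$ is the product of the distinct primes dividing $n$, with $\operatorname{rad}(1)=1$. $\operatorname{ord}_{q^2}(\alpha)$ is the multiplicative order of $\alpha$ in the cyclic group $\mathbb{F}_{q^2}^*$. Irreducible factors are normalized to be monic. (The existence of a non-square forces $q$ to be odd.) *)

(* Defs.v *)
From mathcomp Require Import all_boot all_order all_algebra all_fingroup.

Set Implicit Arguments.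
Unset Strict Implicit.
Unset Printing Implicit Defensive.

Import GRing.Theory.
Local Open Scope ring_scope.

Definition radical_nat (n : nat) : nat := (\prod_(p <- primes n) p)%N.

(* n / (n - i) * 'C(n - i, i) as a natural number; the division is exact by
   dickson_coef_dvd. *)
Definition dickson_coef (n i : nat) : nat := ((n * 'C(n - i, i)) %/ (n - i))%N.

Definition dickson (R : comNzRingType) (n : nat) (a : R) : {poly R} :=
  \sum_(i < n./2.+1) ((dickson_coef n i)%:R * (- a) ^+ i) *: 'X^(n - i.*2).

Lemma dickson_coef_dvd (n i : nat) : (i <= n./2)%N ->
  (n - i %| n * 'C(n - i, i))%N.
Proof.
case: i => [|i] le_i_n2; first by rewrite bin0 muln1 subn0.
have lt_in: (i.+1 <= n)%N.
  by apply: leq_trans le_i_n2 _; rewrite -divn2 leq_div.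
case def_m: (n - i.+1)%N => [|m]; first by rewrite bin0n muln0.
have ->: n = (m.+1 + i.+1)%N by rewrite -def_m subnK.
by rewrite mulnDl -mul_bin_diag -mulnDr dvdn_mulr.
Qed.

(* Main.v *)
Require Import Defs.
From mathcomp Require Import all_boot all_order all_algebra all_fingroup.
From mathcomp Require Import all_solvable all_field.
From mathcomp Require Import zify ring.

Set Implicit Arguments.
Unset Strict Implicit.
Unset Printing Implicit Defensive.

Import GRing.Theory.
Local Open Scope ring_scope.

(* Let theta be a root of f in an algebraic closure and write
   theta = b (g + 1/g); since D_n(y + z, y z) = y^n + z^n, g^(2n) = -1, so the
   order N of g divides 4n and is a multiple of 4. Put Q = q^2,
   t = N / gcd(N, Q - 1) and alpha = g^t, which lies in F_Q and has order
   gcd(N, Q - 1); this gives (i)-(iii). Lifting the exponent, applied to Q = 1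
   modulo every prime dividing N and modulo 4, shows that the t conjugates
   theta^(Q^k), k < t, are distinct: theta^(Q^k) = theta forces g^(Q^k) = g or
   g^(Q^k) = 1/g, and the latter is impossible modulo 4. They are roots of
   D_t(x, a) - b^t (alpha + 1/alpha), which has degree t. Case (a) is exactly
   the condition that this polynomial has coefficients in F_q, and then it is f;
   otherwise f is its product with its conjugate. *)

(** * Coefficients, recurrence and functional equation of the Dickson polynomials *)

Lemma dickson_coef0 (n : nat) : (0 < n)%N -> dickson_coef n 0 = 1%N.
Proof. by move=> n_gt0; rewrite /dickson_coef subn0 bin0 muln1 divnn n_gt0. Qed.

Lemma dickson_coef_small (n i : nat) : (n < i.*2)%N -> dickson_coef n i = 0%N.
Proof.
by move=> lt_n_2i; rewrite /dickson_coef bin_small ?muln0 ?div0n //; lia.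
Qed.

(** Splitting n as (n - i) + i and absorbing i into the binomial clears the division; Pascal's rule
    can then be applied. *)
Lemma dickson_coefS (m i : nat) :
  dickson_coef (m + i).+2 i.+1 = ('C(m.+1, i.+1) + 'C(m, i))%N.
Proof.
rewrite /dickson_coef (_ : (m + i).+2 - i.+1 = m.+1)%N; last by lia.
rewrite (_ : (m + i).+2 = m.+1 + i.+1)%N; last by lia.
by rewrite mulnDl -mul_bin_diag -mulnDr mulKn.
Qed.

Lemma dickson_coef_rec (n i : nat) : (0 < n)%N ->
  dickson_coef n.+2 i.+1 = (dickson_coef n.+1 i.+1 + dickson_coef n i)%N.
Proof.
move=> n_gt0; have [lt_n_2i | le_2i_n] := ltnP n i.*2.
  by rewrite !dickson_coef_small //; lia.
have lt_in : (i < n)%N by lia.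
rewrite -(subnKC lt_in) addnC addnS; move: (n - i.+1)%N => m.
rewrite dickson_coefS -[(m + i).+1]addSn (dickson_coefS m.+1) binS.
case: i {n n_gt0 le_2i_n lt_in} => [|i].
  by rewrite dickson_coef0 // !bin0.
by rewrite addnS addSn dickson_coefS !binS; lia.
Qed.

(** Lets the three sums of the recurrence run over comparable ranges: the added coefficients vanish
    with their binomials. *)
Lemma dickson_widen (R : comNzRingType) (n m : nat) (a : R) : (n./2 < m)%N ->
  dickson n a =
  \sum_(i < m) ((dickson_coef n i)%:R * (- a) ^+ i) *: 'X^(n - i.*2).
Proof.
move=> lt_n2_m; rewrite /dickson.
rewrite (big_ord_widen_cond m xpredT
  (fun i => ((dickson_coef n i)%:R * (- a) ^+ i) *: 'X^(n - i.*2))) //.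
rewrite big_mkcond; apply: eq_bigr => i _ /=.
by case: ltnP => // le_n2_i; rewrite dickson_coef_small ?mul0r ?scale0r //; lia.
Qed.

Lemma dickson1 (R : comNzRingType) (a : R) : dickson 1 a = 'X.
Proof. by rewrite /dickson big_ord1 dickson_coef0 // mulr1 scale1r. Qed.

Lemma dickson2 (R : comNzRingType) (a : R) : dickson 2 a = 'X^2 - (a *+ 2)%:P.
Proof.
rewrite /dickson !big_ord_recl big_ord0 dickson_coef0 // /bump /= addr0.
rewrite (_ : dickson_coef 2 1 = 2) // mulr1 scale1r expr1 -alg_polyC -scaleNr.
by rewrite mulr_natl mulNrn.
Qed.

(** The recurrence starts at n = 1: division by zero makes [dickson 0 a] equal to 0 instead of the
    customary 2. *)
Lemma dickson_rec (R : comNzRingType) (n : nat) (a : R) : (0 < n)%N ->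
  dickson n.+2 a = 'X * dickson n.+1 a - a *: dickson n a.
Proof.
move=> n_gt0.
rewrite (@dickson_widen R n.+2 n.+2) ?(@dickson_widen R n.+1 n.+2); try by lia.
rewrite (@dickson_widen R n n.+1); last by lia.
rewrite big_ord_recl [in RHS]big_ord_recl mulrDr !dickson_coef0 // -addrA.
rewrite !mulr1 !scale1r !subn0 exprS; congr +%R.
rewrite mulr_sumr scaler_sumr -sumrN -big_split; apply: eq_bigr => i _ /=.
rewrite /bump /= !add1n dickson_coef_rec // natrD !mulrDl scalerDl; congr +%R.
  have [lt_n_2i | le_2i_n] := ltnP n.+1 i.+1.*2.
    by rewrite dickson_coef_small // !mul0r !scale0r mulr0.
  by rewrite -scalerAr -exprS -subSn // doubleS !subSS.
by rewrite doubleS !subSS scalerA exprS -scaleNr; congr (_ *: _); ring.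
Qed.

(** Both sides satisfy the linear recurrence with characteristic roots y and z. *)
Lemma horner_dickson (R : comNzRingType) (n : nat) (y z : R) : (0 < n)%N ->
  (dickson n (y * z)).[y + z] = y ^+ n + z ^+ n.
Proof.
case: n => // n _; elim/ltn_ind: n => [[|[|n]]] IHn.
- by rewrite dickson1 hornerX !expr1.
- by rewrite dickson2 !hornerE; ring.
rewrite dickson_rec // !hornerE !IHn // !exprS; ring.
Qed.

Lemma dickson_size_monic (R : comNzRingType) (n : nat) (a : R) : (0 < n)%N ->
  (size (dickson n a) = n.+1) /\ (dickson n a \is monic).
Proof.
move=> n_gt0; have ->: dickson n a = 'X^n + (dickson n a - 'X^n) by ring.
have le_sz : (size (dickson n a - 'X^n)%R < size ('X^n : {poly R}))%N.
  rewrite /dickson big_ord_recl dickson_coef0 // mulr1 scale1r subn0.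
  rewrite addrC addKr.
  rewrite size_polyXn ltnS; apply: (leq_trans (size_sum _ _ _)).
  apply/bigmax_leqP => i _; apply: (leq_trans (size_scale_leq _ _)).
  by rewrite size_polyXn lift0; lia.
by rewrite monicE lead_coefDl // size_polyDl // lead_coefXn size_polyXn.
Qed.

Lemma map_dickson (R S : comNzRingType) (h : {rmorphism R -> S}) (n : nat)
  (a : R) : map_poly h (dickson n a) = dickson n (h a).
Proof.
rewrite rmorph_sum; apply: eq_bigr => i _ /=.
by rewrite map_polyZ map_polyXn rmorphM rmorph_nat rmorphXn rmorphN.
Qed.

(** * Lifting the exponent *)

Lemma geometric_sum_mod2 (p u k : nat) : exists c : nat,
  (\sum_(i < k) (1 + p * u) ^ i = k + p * u * 'C(k, 2) + p ^ 2 * c)%N.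
Proof.
(* Binomial expansion modulo p^2; summing the linear terms over i < k produces 'C(k, 2). *)
have expE i : exists c : nat, ((1 + p * u) ^ i = 1 + i * (p * u) + p ^ 2 * c)%N.
  elim: i => [|i [c IHi]]; first by exists 0%N; rewrite expn0; lia.
  exists (u * (i * u) + c + c * (p * u))%N; rewrite expnS IHi; ring.
elim: k => [|k [c IHk]]; first by exists 0%N; rewrite big_ord0 bin0n !muln0.
have [d Ed] := expE k; exists (c + d)%N.
by rewrite big_ord_recr /= IHk Ed binS bin1; ring.
Qed.

(** With r = p u the sum is p + p u 'C(p, 2) modulo p^2, so it suffices that p divides u 'C(p, 2):
    an odd p divides the binomial, and for p = 2 the condition on r makes u even. *)
Lemma logn_geometric_sum_prime (p r : nat) : prime p -> (p %| r)%N ->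
  (p = 2 -> 4 %| r)%N -> logn p (\sum_(i < p) r.+1 ^ i)%N = 1%N.
Proof.
move=> p_pr /dvdnP[u ->] two; have [c Ec] := geometric_sum_mod2 p u p.
have p_gt0 := prime_gt0 p_pr.
rewrite -add1n mulnC {}Ec.
have [v Ev] : exists v, (u * 'C(p, 2) = p * v)%N.
  have [p2 | p_gt2] := leqP p 2.
    have p2' : p = 2 by apply/eqP; rewrite eqn_leq p2 prime_gt1.
    have := two p2'; rewrite p2' => /dvdnP[w Ew]; exists w; rewrite binn; lia.
  have /dvdnP[w Ew] := @prime_dvd_bin 2 p p_pr (p_gt2 : (0 < 2 < p)%N).
  by exists (u * w)%N; rewrite Ew; ring.
rewrite (_ : p + _ + _ = p * (1 + p * (v + c)))%N; last first.
  by rewrite -mulnA Ev; ring.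
rewrite lognM // logn_prime // eqxx -[RHS]addn0; congr addn.
rewrite logn_coprime // prime_coprime //.
by rewrite dvdn_addl ?dvdn_mulr // gtnNdvd ?prime_gt1.
Qed.

(** Induction on k: each factor p of k contributes a geometric sum of valuation 1. Once p does not
    divide k, the geometric sum is congruent to k modulo p, hence prime to p. *)
Lemma logn_expn_pred (p Q k : nat) : prime p -> (1 < Q)%N -> (p %| Q.-1)%N ->
  (p = 2 -> 4 %| Q.-1)%N -> (0 < k)%N ->
  logn p (Q ^ k).-1 = (logn p Q.-1 + logn p k)%N.
Proof.
move=> p_pr Q_gt1 pQ two; elim/ltn_ind: k => k IHk k_gt0.
have gt0 j : (0 < j)%N -> (0 < (Q ^ j).-1)%N.
  by move=> j_gt0; have := ltn_exp2l 0 j Q_gt1; rewrite expn0; lia.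
have [/dvdnP[m Em] | p'k] := boolP (p %| k)%N.
  have m_gt0 : (0 < m)%N by move: k_gt0; rewrite Em; case: (m).
  have Qm := gt0 _ m_gt0.
  have dQ : (Q.-1 %| (Q ^ m).-1)%N by rewrite predn_exp dvdn_mulr.
  have QmE : (Q ^ m = (Q ^ m).-1.+1)%N by lia.
  have p_gt0 := prime_gt0 p_pr.
  rewrite Em lognM // expnM [(_ ^ p).-1]predn_exp {2}QmE.
  rewrite lognM //; last by rewrite (bigD1 (Ordinal p_gt0)) //= expn0.
  rewrite logn_geometric_sum_prime ?(dvdn_trans pQ dQ) //; last first.
    by move=> p2; apply: dvdn_trans (two p2) dQ.
  have lt_mk : (m < k)%N by rewrite Em ltn_Pmulr // prime_gt1.
  by rewrite IHk // (logn_prime _ p_pr) eqxx addnA.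
rewrite predn_exp lognM; first last.
- by have := gt0 _ k_gt0; rewrite predn_exp muln_gt0 => /andP[].
- by rewrite -ltnS prednK // ltnW.
congr addn; rewrite [RHS]logn_coprime ?prime_coprime // logn_coprime //.
rewrite prime_coprime //; apply: contra p'k.
have [u Eu] := dvdnP pQ; have QE : (1 + p * u = Q)%N by lia.
have [c] := geometric_sum_mod2 p u k; rewrite QE => ->.
by rewrite -addnA dvdn_addl // dvdn_add ?expnS -?mulnA ?dvdn_mulr.
Qed.

Lemma dvdn_expn_pred (N Q k : nat) : (0 < N)%N -> (1 < Q)%N -> (0 < k)%N ->
  (forall p, prime p -> (p %| N)%N -> (p %| Q.-1)%N) -> (4 %| Q.-1)%N ->
  (N %| (Q ^ k).-1)%N -> (N %| Q.-1 * k)%N.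
Proof.
move=> N_gt0 Q_gt1 k_gt0 rad4 dvd4 NQ.
have Qk_gt0 : (0 < (Q ^ k).-1)%N.
  by have := ltn_exp2l 0 k Q_gt1; rewrite expn0; lia.
apply/dvdn_partP => // p; rewrite mem_primes N_gt0 /= => /andP[p_pr pN].
rewrite p_part pfactor_dvdn ?muln_gt0 ?k_gt0 ?andbT //; last by lia.
rewrite lognM //; last by lia.
by rewrite -logn_expn_pred ?(rad4 p) // dvdn_leq_log.
Qed.

(** * Frobenius maps, roots and irreducible polynomials over finite fields *)

Lemma pchar_nat_card (F : finFieldType) : [pchar F].-nat #|F|.
Proof.
have [p p_pr pF] := finPcharP F.
have := abelem_pgroup (fin_ring_pchar_abelem pF); rewrite /pgroup cardsT.
by apply: sub_in_pnat => r _ /eqP->.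
Qed.

(** The polynomial X^|F| - X already splits over F, so all its roots in K come from F. *)
Lemma fixed_card_codom (F : finFieldType) (K : fieldType)
  (j : {rmorphism F -> K}) (x : K) : x ^+ #|F| = x -> exists y, x = j y.
Proof.
move=> xF; have /(congr1 (fun p => (map_poly j p).[x])) := finField_genPoly F.
rewrite rmorphB rmorph_prod /= map_polyXn map_polyX !hornerE xF subrr.
rewrite horner_prod => /esym/eqP/prodf_eq0[y _].
by rewrite rmorphB /= map_polyX map_polyC !hornerE subr_eq0 => /eqP; exists y.
Qed.

Lemma horner_map_card (F : finFieldType) (K : fieldType)
  (j : {rmorphism F -> K}) (p : {poly F}) (x : K) :
  (map_poly j p).[x ^+ #|F|] = (map_poly j p).[x] ^+ #|F|.
Proof.
have pchK : [pchar K].-nat #|F|.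
  by rewrite (eq_pnat _ (fmorph_pchar j)) pchar_nat_card.
elim/poly_ind: p => [|p c IHp].
  by rewrite rmorph0 !horner0 expr0n eqn0Ngt (ltnW (finNzRing_gt1 F)).
rewrite rmorphD rmorphM /= map_polyX map_polyC !hornerE IHp.
by rewrite exprDn_pchar // exprMn -rmorphXn /= expf_card.
Qed.

Lemma root_map_card (F : finFieldType) (K : fieldType)
  (j : {rmorphism F -> K}) (p : {poly F}) (x : K) (k : nat) :
  root (map_poly j p) x -> root (map_poly j p) (x ^+ (#|F| ^ k)).
Proof.
move=> px0; elim: k => [|k IHk]; first by rewrite expn0 expr1.
rewrite expnSr exprM rootE horner_map_card (rootP IHk) expr0n.
by rewrite eqn0Ngt (ltnW (finNzRing_gt1 F)).
Qed.

(** The common root makes the irreducible [f] divide [h], and the distinct roots [rs] push the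
    degree of [f] up to that of [h]. *)
Lemma irreducible_monic_eq (F K : fieldType) (j : {rmorphism F -> K})
  (f h : {poly F}) (rs : seq K) (theta : K) :
  irreducible_poly f -> f \is monic -> h \is monic ->
  root (map_poly j f) theta -> root (map_poly j h) theta ->
  uniq rs -> all (root (map_poly j f)) rs -> (size h <= (size rs).+1)%N ->
  f = h.
Proof.
move=> f_irr f_mon h_mon f0 h0 Urs f_rs sz_h; apply/eqP.
have f_neq0 := monic_neq0 f_mon.
have f_h : f %| h.
  apply: contraLR (h0); rewrite -(irreducible_poly_coprime _ f_irr).
  by rewrite -(coprimep_map j) => /coprimep_root/(_ f0).
rewrite -eqp_monic // -(dvdp_size_eqp f_h) eqn_leq.
rewrite (dvdp_leq (monic_neq0 h_mon)) //=.
apply: leq_trans sz_h _; rewrite -(size_map_poly j).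
by apply: max_poly_roots; rewrite ?map_poly_eq0 // uniq_rootsE.
Qed.

(** Serves twice: to separate the conjugates of theta, and to match the condition of case (a). *)
Lemma addV_eq (K : fieldType) (x y : K) : x != 0 -> y != 0 ->
  (x + x^-1 == y + y^-1) = (x == y) || (x * y == 1).
Proof.
move=> x0 y0; rewrite -subr_eq0 -[x == y]subr_eq0 -[x * y == 1]subr_eq0.
rewrite -mulf_eq0.
have -> : x + x^-1 - (y + y^-1) = (x - y) * (x * y - 1) / (x * y).
  by field; rewrite x0 y0.
by rewrite [LHS]mulf_eq0 invr_eq0 (mulf_eq0 x y) (negPf x0) (negPf y0) !orbF.
Qed.

Lemma exprpchar_inj (K : fieldType) (Q : nat) : [pchar K].-nat Q ->
  injective (fun x : K => x ^+ Q).
Proof.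
move=> pchQ x y /= eq_xy; apply/eqP; rewrite -subr_eq0.
have : (x - y) ^+ Q == 0 by rewrite exprDn_pchar // exprNn_pchar // eq_xy subrr.
by rewrite expf_eq0 => /andP[].
Qed.

Lemma coprime_div_gcd (m n : nat) : (0 < m)%N ->
  coprime (m %/ gcdn m n) (n %/ gcdn m n).
Proof.
move=> m_gt0; have g_gt0 : (0 < gcdn m n)%N by rewrite gcdn_gt0 m_gt0.
rewrite /coprime -(eqn_pmul2r g_gt0) muln_gcdl mul1n.
by rewrite !divnK ?dvdn_gcdl ?dvdn_gcdr.
Qed.

Lemma frobenius_orbit_uniq (K : fieldType) (Q N : nat) (B g : K) :
  [pchar K].-nat Q -> (1 < Q)%N -> (4 %| Q.-1)%N ->
  N.-primitive_root g -> (4 %| N)%N ->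
  (forall p, prime p -> (p %| N)%N -> (p %| Q.-1)%N) ->
  B != 0 -> B ^+ Q = B ->
  uniq (mkseq (fun k => (B * (g + g^-1)) ^+ (Q ^ k)) (N %/ gcdn N Q.-1)).
Proof.
move=> pchQ Q_gt1 dvd4Q prim_g dvd4N radN B_neq0 BQ.
set theta := B * _; set t := (N %/ _)%N.
have pchQk k : [pchar K].-nat (Q ^ k)%N by rewrite pnatX pchQ.
have N_gt0 := prim_order_gt0 prim_g.
have g_neq0 : g != 0 by rewrite (prim_root_eq0 prim_g) -lt0n.
have BQk k : B ^+ (Q ^ k) = B.
  by elim: k => [|k IHk]; rewrite ?expn0 ?expr1 // expnSr exprM IHk.
have Qk_gt0 k : (0 < Q ^ k)%N by rewrite expn_gt0 (ltnW Q_gt1).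
have theta_fix k : (k < t)%N -> theta ^+ (Q ^ k) = theta -> k = 0%N.
  move=> lt_kt /eqP; rewrite exprMn BQk exprDn_pchar // exprVn.
  rewrite (inj_eq (mulfI B_neq0)) addV_eq ?expf_neq0 //.
  case/orP => [|/eqP gV].
    (* Here N divides Q^k - 1, hence (Q - 1) k by lifting the exponent; so t divides k, which
       excludes 0 < k < t. *)
    rewrite -(inj_eq (mulIf (_ : g^-1 != 0))) ?invr_eq0 // mulfV //.
    rewrite -(prednK (Qk_gt0 k)) exprSr mulfK // -(prim_order_dvd prim_g).
    case: k lt_kt => // k lt_kt.
    move/(dvdn_expn_pred N_gt0 Q_gt1 (ltn0Sn k) radN dvd4Q).
    rewrite -{1}(divnK (dvdn_gcdl N Q.-1)) -/t.
    rewrite -{2}(divnK (dvdn_gcdr N Q.-1)) mulnAC.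
    rewrite dvdn_pmul2r ?gcdn_gt0 ?N_gt0 //.
    rewrite Gauss_dvdr; first by move/dvdn_leq => /(_ isT); lia.
    exact: coprime_div_gcd.
  (* Here 4 would divide both Q^k + 1 and Q^k - 1. *)
  move/eqP: gV; rewrite -exprSr -(prim_order_dvd prim_g) => /(dvdn_trans dvd4N).
  have : (4 %| (Q ^ k).-1)%N by rewrite predn_exp dvdn_mulr.
  have := Qk_gt0 k; lia.
suff wlog_inj i k : (i + k < t)%N ->
    theta ^+ (Q ^ i) = theta ^+ (Q ^ (i + k)) -> k = 0%N.
  apply/mkseq_uniqP => i k; rewrite !inE => lt_it lt_kt Eik.
  have [le_ik | /ltnW le_ki] := leqP i k.
    by have := @wlog_inj i (k - i)%N; rewrite subnKC // => /(_ lt_kt Eik); lia.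
  have := @wlog_inj k (i - k)%N; rewrite subnKC // => /(_ lt_it (esym Eik)).
  lia.
move=> lt_ikt; rewrite addnC expnD exprM => /(exprpchar_inj (pchQk i))/esym.
by apply: theta_fix; lia.
Qed.

(** * Arithmetic of orders, gcds and radicals *)

Lemma dvdn4_order (n N : nat) : (N %| 4 * n)%N -> ~~ (N %| 2 * n)%N ->
  (4 %| N)%N.
Proof.
move=> /dvdnP[c Ec] not2n; rewrite -(@Gauss_dvdr 4 c).
  by rewrite -Ec dvdn_mulr.
(* An even cofactor c could be halved, giving N | 2n. *)
rewrite (@coprimeXl 2 2) // coprime2n; apply: contraNT not2n => even_c.
apply/dvdnP; exists c./2; have := even_halfK even_c; lia.
Qed.

(** As 4 divides the gcd, 4t divides N and hence 4n. This makes the exponent 2n/t in (i) an exact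
    quotient. *)
Lemma dvdn_order_quotient (n N m : nat) : (0 < n)%N -> (0 < m)%N ->
  (4 %| m)%N -> (N %| 4 * n)%N -> (4 %| N)%N ->
  (N %/ gcdn N m %| n)%N.
Proof.
move=> n_gt0 m_gt0 dvd4m /dvdnP[c Ec] dvd4N.
have /dvdnP[d Ed] : (4 %| gcdn N m)%N by rewrite dvdn_gcd dvd4N.
have := divnK (dvdn_gcdl N m); move: (N %/ _)%N => t Et.
by apply/dvdnP; exists (c * d)%N; rewrite Ed in Et; nia.
Qed.

(** The left side divides M / gcd(N, m), and it is coprime to the excess factor gcd(M, m) / gcd(N,
    m), which divides m / gcd(N, m). *)
Lemma dvdn_quotient_gcd (N M m : nat) : (0 < N)%N -> (N %| M)%N ->
  (N %/ gcdn N m %| M %/ gcdn M m)%N.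
Proof.
move=> N_gt0 NM; have [->|M_gt0] := posnP M; first by rewrite div0n dvdn0.
have G_gt0 : (0 < gcdn M m)%N by rewrite gcdn_gt0 M_gt0.
have gG : (gcdn N m %| gcdn M m)%N.
  by rewrite dvdn_gcd dvdn_gcdr (dvdn_trans (dvdn_gcdl _ _)).
have co : coprime (N %/ gcdn N m) (gcdn M m %/ gcdn N m).
  apply: coprime_dvdr (coprime_div_gcd m N_gt0).
  by rewrite dvdn_divRL ?dvdn_gcdr // divnK ?dvdn_gcdr.
rewrite -(Gauss_dvdl _ co) -(@dvdn_pmul2r (gcdn N m)) ?gcdn_gt0 ?N_gt0 //.
by rewrite divnK ?dvdn_gcdl // -mulnA divnK // divnK ?dvdn_gcdl.
Qed.

Lemma prime_dvd_radical (p m : nat) : (0 < m)%N -> prime p -> (p %| m)%N ->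
  (p %| radical_nat m)%N.
Proof.
move=> m_gt0 p_pr pm; rewrite /radical_nat.
by rewrite (big_rem p) ?mem_primes ?p_pr ?m_gt0 //= dvdn_mulr.
Qed.

Lemma radical_dvd (m d : nat) :
  (forall p, prime p -> (p %| m)%N -> (p %| d)%N) -> (radical_nat m %| d)%N.
Proof.
move=> md; rewrite /radical_nat.
have : all (fun p => prime p && (p %| d)%N) (primes m).
  by apply/allP => p; rewrite mem_primes => /and3P[p_pr _ pm]; rewrite p_pr md.
have := primes_uniq m; elim: (primes m) => [|p s IHs] /=.
  by rewrite big_nil dvd1n.
rewrite big_cons => /andP[ps Us] /andP[/andP[p_pr pd] /[dup] s_d /(IHs Us) sd].
rewrite Gauss_dvd ?pd // prime_coprime // Euclid_dvd_prod // big_has.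
apply/hasPn => r rs; have /andP[r_pr _] := allP s_d r rs.
by rewrite dvdn_prime2 //; apply: contraNneq ps => ->.
Qed.

(** * Parity of q and roots of the Dickson polynomial *)

Lemma even_card_square (F : finFieldType) (a : F) : ~~ odd #|F| ->
  exists c : F, c ^+ 2 = a.
Proof.
move=> evenF; exists (a ^+ #|F|./2).
by rewrite -exprM muln2 even_halfK // expf_card.
Qed.

Lemma dickson_root (K : closedFieldType) (n : nat) (B theta : K) :
  (0 < n)%N -> B != 0 -> root (dickson n (B ^+ 2)) theta ->
  exists g : K, [/\ g != 0, theta = B * (g + g^-1) & g ^+ (2 * n) = -1].
Proof.
move=> n_gt0 B_neq0 theta0.
(* The roots of this quadratic are the solutions g of theta = B (g + 1/g). *)
pose p := 'X^2 - (theta / B) *: 'X + 1 : {poly K}.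
have sz_p : size p = 3.
  rewrite /p -addrA size_polyDl size_polyXn //.
  apply: leq_ltn_trans (size_polyD _ _) _; rewrite gtn_max size_poly1 andbT.
  by rewrite size_polyN (leq_ltn_trans (size_scale_leq _ _)) // size_polyX.
have /closed_rootP[g] : size p != 1%N by rewrite sz_p.
rewrite rootE !hornerE => /eqP pg.
have g_neq0 : g != 0.
  by apply: contra_eq_neq pg => ->; rewrite expr0n mulr0 subr0 add0r oner_eq0.
have theta_g : theta = B * (g + g^-1).
  have -> : theta = theta / B * B by rewrite divfK.
  have -> : theta / B = (g ^+ 2 + 1) / g.
    apply: (canRL (mulfK g_neq0)); apply/eqP; rewrite -subr_eq0 -oppr_eq0 -pg.
    by apply/eqP; ring.
  by field.
exists g; split => //; move: theta0; rewrite theta_g rootE.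
(* With theta = B g + B/g, the functional equation gives B^n (g^n + g^-n) = 0. *)
have -> : B ^+ 2 = (B * g) * (B * g^-1) by field.
rewrite mulrDr horner_dickson // !exprMn -mulrDr mulf_eq0 expf_eq0.
rewrite (negPf B_neq0) andbF /= exprVn mulnC exprM => /eqP gn.
apply/eqP; rewrite -subr_eq0.
rewrite -(mulr0 (g ^+ n)) -gn; apply/eqP; field.
by rewrite expf_neq0.
Qed.

Lemma dicksonBc (R : comNzRingType) (t : nat) (a c : R) : (0 < t)%N ->
  (size (dickson t a - c%:P) = t.+1) /\ (dickson t a - c%:P \is monic).
Proof.
move=> t_gt0; have [sz_D mon_D] := dickson_size_monic a t_gt0.
have lt_c : (size (- c%:P)%R < size (dickson t a))%N.
  by rewrite size_polyN sz_D (leq_ltn_trans (size_polyC_leq1 c)).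
by rewrite monicE lead_coefDl // size_polyDl.
Qed.

(** * From a root of [f] to [alpha], [t] and the factorization *)

Theorem theorem3p3 (q : nat) (F L : finFieldType) (iota : {rmorphism F -> L})
    (card_F : #|F| = q) (card_L : #|L| = (q ^ 2)%N)
    (a : F) (a_nonsquare : ~ exists c : F, c ^+ 2 = a)
    (b : L) (b_notin_F : b \notin codom iota) (b_sqr : b ^+ 2 = iota a)
    (n : nat) (n_gt0 : (0 < n)%N) (rad_n : (radical_nat n %| q - 1)%N)
    (f : {poly F}) (f_monic : f \is monic) (f_irr : irreducible_poly f)
    (f_dvd : f %| dickson n a) :
  exists (u : {unit L}) (t : nat),
    let alpha : L := val u in
    [/\ (0 < t)%N /\ (t %| (4 * n) %/ gcdn (4 * n) (q ^ 2 - 1))%N,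
        alpha ^+ ((2 * n) %/ t) = -1,
        (radical_nat t %| #[u]%g)%N,
        gcdn t ((q ^ 2 - 1) %/ #[u]%g) = 1%N &
        if ~~ odd t && ((alpha \in codom iota) || (alpha ^+ (q + 1) == 1))
           || odd t && ((alpha ^+ (q - 1) == -1) || (alpha ^+ (q + 1) == -1))
        then map_poly iota f
             = dickson t (iota a) - (b ^+ t * (alpha + alpha^-1))%:P
        else map_poly iota f
             = (dickson t (iota a) - (b ^+ t * (alpha + alpha^-1))%:P)
               * (dickson t (iota a)
                  - (b ^+ (q * t) * (alpha ^+ q + alpha ^- q))%:P)].
Proof.
have odd_q : odd q.
  by apply: contra_notT a_nonsquare; rewrite -card_F; apply: even_card_square.
have q_gt1 : (1 < q)%N by rewrite -card_F finNzRing_gt1.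
have Q_gt1 : (1 < q ^ 2)%N by rewrite -card_L finNzRing_gt1.
have QE : (q ^ 2 - 1 = (q - 1) * (q + 1))%N by rewrite -{2}(exp1n 2) subn_sqr.
have dvd4Q : (4 %| q ^ 2 - 1)%N.
  by rewrite QE -[4%N]/(2 * 2)%N dvdn_mul // dvdn2 ?oddD ?oddB ?odd_q // ltnW.
have pchL : [pchar L].-nat q.
  by rewrite (eq_pnat _ (fmorph_pchar iota)) -card_F pchar_nat_card.
have fixF (x : L) : x ^+ q = x -> exists y, x = iota y.
  by rewrite -card_F; apply: fixed_card_codom.
have iota_q x : iota x ^+ q = iota x by rewrite -rmorphXn -card_F /= expf_card.
have L_Q (x : L) : x ^+ (q ^ 2) = x by rewrite -card_L expf_card.
have b_neq0 : b != 0.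
  by apply: contraNneq b_notin_F => ->; rewrite -(rmorph0 iota) codom_f.
(* The square of b^q is a^q = a, so b^q is b or -b, and the former would put b in F. *)
have bq : b ^+ q = - b.
  have /eqP := etrans (exprAC b q 2) (congr1 (fun x => x ^+ q) b_sqr).
  rewrite iota_q -b_sqr eqf_sqr => /orP[/eqP/fixF[y Ey] | /eqP //].
  by rewrite Ey codom_f in b_notin_F.
(* In characteristic 2, -b = b would be fixed by Frobenius and lie in F. *)
have two_neq0 : 1 + 1 != 0 :> L.
  apply: contraNneq b_notin_F => two0; have [|y ->] := fixF b; last first.
    exact: codom_f.
  apply/eqP; rewrite bq eq_sym -addr_eq0 -[b]mulr1 -mulrDr two0.
  by rewrite mulr0.
have [K [j _]] := countable_algebraic_closure L.
pose jF : {rmorphism F -> K} := j \o iota.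
have map_jF p : map_poly jF p = map_poly j (map_poly iota p).
  by rewrite map_poly_comp.
have pchK : [pchar K].-nat q.
  by rewrite (eq_pnat _ (fmorph_pchar j)).
pose Q := (q ^ 2)%N.
have [theta f_theta] : exists theta, root (map_poly jF f) theta.
  by apply/closed_rootP; rewrite size_map_poly neq_ltn f_irr.1 orbT.
pose B := j b.
have B_neq0 : B != 0 by rewrite fmorph_eq0.
have jFa : jF a = B ^+ 2 by rewrite /B -rmorphXn b_sqr.
have [g [g_neq0 theta_g g2n]] : exists g : K,
  [/\ g != 0, theta = B * (g + g^-1) & g ^+ (2 * n) = -1].
  apply: dickson_root => //; rewrite -jFa -map_dickson.
  by apply: root_dvdp f_theta; rewrite dvdp_map.
have g4n : g ^+ (4 * n) = 1.
  by rewrite -[4%N]/(2 * 2)%N -mulnA mulnC exprM g2n sqrrN expr1n.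
have n4_gt0 : (0 < 4 * n)%N by rewrite muln_gt0.
have [N prim_g N4n] := prim_order_exists n4_gt0 g4n.
have N_gt0 := prim_order_gt0 prim_g.
have N2n : ~~ (N %| 2 * n)%N.
  rewrite (prim_order_dvd prim_g) g2n eq_sym -subr_eq0 opprK -(rmorph1 j).
  by rewrite -rmorphD fmorph_eq0.
have dvd4N := dvdn4_order N4n N2n.
have [m mE] : exists m, m = (q ^ 2 - 1)%N by exists (q ^ 2 - 1)%N.
have m_gt0 : (0 < m)%N by rewrite mE subn_gt0.
rewrite -mE in dvd4Q QE *.
have gcd_gt0 : (0 < gcdn N m)%N by rewrite gcdn_gt0 N_gt0.
have [t tE] : exists t, t = (N %/ gcdn N m)%N by exists (N %/ gcdn N m)%N.
have NE : (t * gcdn N m = N)%N by rewrite tE divnK ?dvdn_gcdl.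
have t_gt0 : (0 < t)%N by move: N_gt0; rewrite -{1}NE muln_gt0 => /andP[].
have t_n : (t %| n)%N by rewrite tE dvdn_order_quotient.
have radN p : prime p -> (p %| N)%N -> (p %| m)%N.
  move=> p_pr pN; have := dvdn_trans pN N4n; rewrite Euclid_dvdM //.
  case/orP=> [p4|pn]; first exact: dvdn_trans p4 dvd4Q.
  rewrite QE dvdn_mulr // (dvdn_trans _ rad_n) //.
  exact: prime_dvd_radical.
(* N = t gcd(N, m) divides t m, so g^t is fixed by the q^2-power map and comes from L. *)
have [alpha alphaE] : exists alpha, g ^+ t = j alpha.
  apply: fixed_card_codom; rewrite card_L -(subnK (ltnW Q_gt1)) -mE.
  rewrite addn1 exprSr.
  rewrite -exprM (_ : g ^+ (t * m) = 1) ?mul1r //.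
  apply/eqP; rewrite -(prim_order_dvd prim_g).
  by rewrite -{1}NE dvdn_mul // dvdn_gcdr.
have alpha_neq0 : alpha != 0 by rewrite -(fmorph_eq0 j) -alphaE expf_neq0.
have alphaU : alpha \is a GRing.unit by rewrite unitfE.
pose u : {unit L} := FinRing.unit L alphaU.
have ord_u : #[u]%g = gcdn N m.
  have ordP i : (#[u]%g %| i)%N = (gcdn N m %| i)%N.
    rewrite order_dvdn -val_eqE /= FinRing.val_unitX /=.
    rewrite -(inj_eq (fmorph_inj j)) rmorphXn rmorph1 /= -alphaE -exprM.
    rewrite -(prim_order_dvd prim_g) -{1}NE.
    by rewrite dvdn_pmul2l.
  by apply/eqP; rewrite eqn_dvd ordP dvdnn -ordP dvdnn.
exists u, t => /=; split.
- by rewrite t_gt0 tE dvdn_quotient_gcd.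
- apply: (fmorph_inj j); rewrite rmorphXn rmorphN1 /= -alphaE -exprM mulnC.
  by rewrite divnK // dvdn_mull.
- apply: radical_dvd => p p_pr pt; rewrite ord_u.
  have pN : (p %| N)%N by rewrite -NE dvdn_mulr.
  by rewrite dvdn_gcd pN radN.
- by rewrite ord_u tE; apply/eqP/coprime_div_gcd.
set s := b ^+ t * _; set s' := b ^+ (q * t) * _.
have sq : s ^+ q = s'.
  by rewrite /s /s' exprMn exprDn_pchar // exprVn -exprM mulnC.
have s'q : s' ^+ q = s by rewrite -sq -exprM L_Q.
(* Since b^(qt) = (-1)^t b^t, equality of s' and s compares alpha^q + alpha^-q with the same
   expression in alpha for even t and in -alpha for odd t; [addV_eq] then yields the two
   alternatives. *)
have condE : ~~ odd t && ((alpha \in codom iota) || (alpha ^+ (q + 1) == 1))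
   || odd t && ((alpha ^+ (q - 1) == -1) || (alpha ^+ (q + 1) == -1))
   = (s' == s).
  have aq_neq0 : alpha ^+ q != 0 by rewrite expf_neq0.
  rewrite /s /s' exprM bq exprNn -mulrA [b ^+ t * _]mulrC -signr_odd.
  have bt_neq0 : b ^+ t != 0 by rewrite expf_neq0.
  rewrite [_ ^+ odd t * _]mulrCA [_ * b ^+ t]mulrC (inj_eq (mulfI bt_neq0)).
  rewrite addn1 exprSr; case: (odd t); last first.
    rewrite expr0 mul1r addV_eq // orbF; congr (_ || _).
    apply/codomP/eqP => [[y ->] | /fixF]; first exact: iota_q.
    by [].
  have aN_neq0 : - alpha != 0 by rewrite oppr_eq0.
  rewrite expr1 mulN1r eqr_oppLR opprD -invrN addV_eq // mulrN.
  rewrite andFb orFb andTb; congr (_ || _); last by rewrite eqr_oppLR.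
  rewrite -(inj_eq (mulIf alpha_neq0)) -exprSr -subSn ?(ltnW q_gt1) //.
  by rewrite subSS subn0 mulN1r.
rewrite condE.
have orbit_uniq : uniq (mkseq (fun k => theta ^+ (Q ^ k)) t).
  have mP : m = Q.-1 by rewrite mE subn1.
  rewrite theta_g tE mP; apply: frobenius_orbit_uniq => //; rewrite -?mP //.
    by rewrite pnatX pchK.
  by rewrite /B -rmorphXn L_Q.
have D_theta : (dickson t (B ^+ 2)).[theta] = j s.
  have -> : B ^+ 2 = (B * g) * (B * g^-1) by field.
  rewrite theta_g mulrDr horner_dickson // !exprMn -mulrDr /s rmorphM rmorphXn.
  by rewrite rmorphD fmorphV /= -alphaE exprVn.
have D_theta_q : (dickson t (B ^+ 2)).[theta ^+ q] = j s'.
  rewrite -jFa -map_dickson -card_F horner_map_card map_dickson jFa D_theta.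
  by rewrite card_F -sq rmorphXn.
clearbody s s'.
have f_orbit x k :
    root (map_poly jF f) x -> root (map_poly jF f) (x ^+ (Q ^ k)).
  by move=> fx; rewrite /Q -expnM -card_F root_map_card.
have gE c x : root (map_poly j (dickson t (iota a) - c%:P)) x =
    ((dickson t (B ^+ 2)).[x] == j c).
  by rewrite rmorphB /= map_dickson map_polyC -jFa rootE !hornerE subr_eq0.
(* D_t - c has coefficients in L, so the q^2-power map permutes its roots. *)
have g_orbit c x k : (dickson t (B ^+ 2)).[x] = j c ->
    (dickson t (B ^+ 2)).[x ^+ (Q ^ k)] = j c.
  move/eqP; rewrite -gE => gx; apply/eqP.
  by rewrite -gE /Q -card_L root_map_card.
have [s'_s | s'_neq_s] := eqVneq s' s.
  (* Case (a): s lies in F, and the t conjugates of theta match the degree of D_t - s. *)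
  have [c cE] := fixF s (etrans sq s'_s).
  have [sz_h mon_h] := dicksonBc a c t_gt0.
  rewrite (_ : f = dickson t a - c%:P); last first.
    apply: (irreducible_monic_eq f_irr f_monic mon_h f_theta _ orbit_uniq).
    - by rewrite map_jF rmorphB /= map_dickson map_polyC /= -cE gE D_theta.
    - by apply/allP => _ /mapP[k _ ->]; apply: f_orbit.
    - by rewrite size_mkseq sz_h.
  by rewrite rmorphB /= map_dickson map_polyC /= -cE.
(* Case (b): Frobenius swaps s and s', so their sum and product, the coefficients needed for [h],
   lie in F. *)
have [c cE] : exists c, s + s' = iota c.
  by apply: fixF; rewrite exprDn_pchar // sq s'q addrC.
have [d dE] : exists d, s * s' = iota d.
  by apply: fixF; rewrite exprMn sq s'q mulrC.
have [sz_1 mon_1] := dicksonBc (iota a) s t_gt0.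
have [sz_2 mon_2] := dicksonBc (iota a) s' t_gt0.
pose h := dickson t a ^+ 2 - c%:P * dickson t a + d%:P.
have hE : map_poly iota h =
    (dickson t (iota a) - s%:P) * (dickson t (iota a) - s'%:P).
  rewrite rmorphD rmorphB rmorphXn rmorphM /= !map_polyC /= map_dickson.
  by rewrite -cE -dE polyCD polyCM; ring.
rewrite -hE; congr map_poly.
pose orbit := mkseq (fun k => theta ^+ (Q ^ k)) t.
(* The degree 2t of [h] is matched by the orbit of theta and its image under the q-power map. *)
apply: (@irreducible_monic_eq _ _ jF _ _
  (orbit ++ map (fun x => x ^+ q) orbit) theta) => //.
- by rewrite -(map_monic iota) hE monicMr.
- by rewrite map_jF hE rmorphM rootM gE D_theta eqxx.
- rewrite cat_uniq (map_inj_uniq (exprpchar_inj pchK)) orbit_uniq andbT.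
  (* The two halves are disjoint: D_t equals s on the orbit and s' on its image. *)
  apply/hasPn => _ /mapP[_ /mapP[k _ ->] ->]; apply/mapP => -[i _ Ei].
  have := g_orbit s theta i D_theta; rewrite -Ei exprAC.
  by rewrite (g_orbit s' _ k D_theta_q) => /fmorph_inj /eqP; apply/negP.
- apply/allP => x; rewrite mem_cat => /orP[/mapP[k _ ->] | ].
    exact: f_orbit.
  case/mapP => _ /mapP[k _ ->] ->.
  move: (root_map_card 1 (f_orbit theta k f_theta)).
  by rewrite card_F expn1.
- rewrite -(size_map_poly iota) hE size_monicM ?monic_neq0 // sz_1 sz_2.
  by rewrite size_cat !size_map size_iota addSn addnS.
Qed.
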